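(* Let $\boldsymbol{x}_1,\ldots,\boldsymbol{x}_n$ be $\mathbb{R}^d$-valued random vectors with means $\bar{\boldsymbol{x}}_i=\mathbb{E}\boldsymbol{x}_i$ and finite variances $\mathrm{tr}\,\mathbb{V}[\boldsymbol{x}_i]<\infty$, and let $\bar{\boldsymbol{x}}=\frac1n\sum_{i=1}^n\bar{\boldsymbol{x}}_i$. Suppose there is $\rho\in[0,1]$ such that for all $i\neq j$ $$\mathrm{tr}\,\mathrm{Cov}(\boldsymbol{x}_i,\boldsymbol{x}_j)\le\rho\,\sqrt{\mathrm{tr}\,\mathbb{V}[\boldsymbol{x}_i]}\,\sqrt{\mathrm{tr}\,\mathbb{V}[\boldsymbol{x}_j]}.\qquad(\ast)$$ Let $B\sim\pi$ be a random minibatch of size $b$ drawn by an unbiased subsampling strategy $\pi$ with effective sample size $b_{\mathrm{eff}}$, independent of $(\boldsymbol{x}_1,\ldots,\boldsymbol{x}_n)$, and let $\boldsymbol{x}_B=\frac1b\sum_{i\in B}\boldsymbol{x}_i$. Then $$\mathrm{tr}\,\mathbb{V}[\boldsymbol{x}_B]\le V_{\mathrm{com}}+V_{\mathrm{cor}}+V_{\mathrm{sub}},$$ where $$V_{\mathrm{com}}=\Big(\frac{\rho}{b_{\mathrm{eff}}}+\frac{1-\rho}{b}\Big)\Big(\frac1n\sum_{i=1}^n\mathrm{tr}\,\mathbb{V}[\boldsymbol{x}_i]\Big),\quad V_{\mathrm{cor}}=\rho\Big(1-\frac1{b_{\mathrm{eff}}}\Big)\Big(\frac1n\sum_{i=1}^n\sqrt{\mathrm{tr}\,\mathbb{V}[\boldsymbol{x}_i]}\Big)^2,\quad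 V_{\mathrm{sub}}=\frac1{b_{\mathrm{eff}}}\,\frac1n\sum_{i=1}^n\|\bar{\boldsymbol{x}}_i-\bar{\boldsymbol{x}}\|_2^2 .$$ Moreover, equality holds when $(\ast)$ holds with equality for all $i\ne j$.
   Context: $\mathbb{V}[\boldsymbol{x}]$ is the covariance matrix of $\boldsymbol{x}$, so $\mathrm{tr}\,\mathbb{V}[\boldsymbol{x}]=\mathbb{E}\|\boldsymbol{x}-\mathbb{E}\boldsymbol{x}\|_2^2$, and $\mathrm{tr}\,\mathrm{Cov}(\boldsymbol{x},\boldsymbol{y})=\mathbb{E}\langle\boldsymbol{x}-\mathbb{E}\boldsymbol{x},\boldsymbol{y}-\mathbb{E}\boldsymbol{y}\rangle$. A subsampling strategy $\pi$ of size $b$ is a probability distribution on subsets $B\subseteq\{1,\ldots,n\}$ of cardinality $|B|=b$, $1\le b\le n$. It is unbiased if $\mathbb{E}_{B\sim\pi}[\frac1b\sum_{i\in B}\boldsymbol{v}_i]=\frac1n\sum_{i=1}^n\boldsymbol{v}_i$ for all vectors $\boldsymbol{v}_1,\ldots,\boldsymbol{v}_n$ (of any dimension). It has effective sample size $b_{\mathrm{eff}}\in[1,\infty]$ if for all vectors $\boldsymbol{v}_1,\ldots,\boldsymbol{v}_n$ with average $\bar{\boldsymbol{v}}$, $\mathrm{tr}\,\mathbb{V}_{B\sim\pi}[\frac1b\sum_{i\in B}\boldsymbol{v}_i]=\frac{1}{b_{\mathrm{eff}}}\frac1n\sum_{i=1}^n\|\boldsymbol{v}_i-\bar{\boldsymbol{v}}\|_2^2$,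 with $1/\infty=0$. (For example, uniform sampling without replacement has $b_{\mathrm{eff}}=(n-1)b/(n-b)$.) *)

(* Defs.v *)
From HB Require Import structures.
From mathcomp Require Import all_boot all_order all_algebra.
From mathcomp Require Import all_classical all_reals all_analysis.

Set Implicit Arguments.
Unset Strict Implicit.
Unset Printing Implicit Defensive.

Import Order.TTheory GRing.Theory Num.Theory.
Import numFieldNormedType.Exports.

Local Open Scope classical_set_scope.
Local Open Scope ring_scope.

(* Finite sets carry the discrete sigma-algebra, so that a probability
   distribution on subsets of {1, ..., n} is a [probability {set 'I_n} R] and a
   random subset is a [{RV P >-> {set 'I_n}}]. *)
HB.instance Definition _ (I : finType) :=
  isPointed.Build {set I} (@finset.set0 I).

HB.instance Definition _ (I : finType) :=
  @isMeasurable.Build default_measure_display {set I}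
    (@discrete_measurable {set I}) (@discrete_measurable0 _)
    (@discrete_measurableC _) (@discrete_measurableU _).

(* The norm that the library puts on row vectors is the sup norm. *)
Definition l2norm (R : realType) (m : nat) (v : 'rV[R]_m) : R :=
  Num.sqrt (\sum_(k < m) (v ord0 k) ^+ 2).

Definition average (R : realType) (n m : nat) (v : 'I_n -> 'rV[R]_m) :
    'rV[R]_m :=
  n%:R^-1 *: \sum_(i < n) v i.

Section random_vectors.
Context (disp : measure_display) (T : measurableType disp) (R : realType).
Variable P : probability T R.

Definition coordinate (m : nat) (X : T -> 'rV[R]_m) (k : 'I_m) : T -> R :=
  fun w => X w ord0 k.

(* The Borel sigma-algebra of R^m is the product one, so measurability of a
   random vector is measurability of its coordinates; it is part of
   [integrable]. *)
Definition integrable_vector (m : nat) (X : T -> 'rV[R]_m) : Prop :=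
  forall k, P.-integrable [set: T] (EFin \o coordinate X k).

Definition mean_vector (m : nat) (X : T -> 'rV[R]_m) : 'rV[R]_m :=
  \row_k fine ('E_P[coordinate X k])%E.

(* Entries are extended reals: an infinite variance stays +oo. *)
Definition covariance_mx (m : nat) (X Y : T -> 'rV[R]_m) : 'M[\bar R]_m :=
  \matrix_(k, l) covariance P (coordinate X k) (coordinate Y l).

Definition tr_cov (m : nat) (X Y : T -> 'rV[R]_m) : \bar R :=
  \tr (covariance_mx X Y).

Definition tr_var (m : nat) (X : T -> 'rV[R]_m) : \bar R := tr_cov X X.

Definition sigma_vectors (n m : nat) (x : 'I_n -> T -> 'rV[R]_m) :
    set (set T) :=
  <<s \bigcup_(i in [set: 'I_n]) \bigcup_(k in [set: 'I_m])
        preimage_set_system [set: T] (coordinate (x i) k) measurable >>.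

Definition independent_sets (F G : set (set T)) : Prop :=
  forall A C, F A -> G C -> P (A `&` C) = (P A * P C)%E.

Definition independent_of_vectors (disp' : measure_display)
    (T' : measurableType disp') (B : T -> T')
    (n m : nat) (x : 'I_n -> T -> 'rV[R]_m) : Prop :=
  independent_sets (preimage_set_system [set: T] B measurable)
    (sigma_vectors x).

End random_vectors.

Section subsampling.
Context (R : realType) (n b : nat).

Definition minibatch_mean (m : nat) (v : 'I_n -> 'rV[R]_m) (B : {set 'I_n}) :
    'rV[R]_m :=
  b%:R^-1 *: \sum_(i in B) v i.

Variable pi : probability {set 'I_n} R.

Definition subsampling_strategy : Prop :=
  (1 <= b <= n)%N /\ pi [set B : {set 'I_n} | #|B| = b] = 1%E.

Definition unbiased_strategy : Prop :=
  forall (m : nat) (v : 'I_n -> 'rV[R]_m),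
    mean_vector pi (minibatch_mean v) = average v.

(* For extended reals, [+oo^-1 = 0]. *)
Definition effective_sample_size (beff : \bar R) : Prop :=
  (1 <= beff)%E /\
  forall (m : nat) (v : 'I_n -> 'rV[R]_m),
    tr_var pi (minibatch_mean v) =
    (beff^-1 *
      (n%:R^-1 * \sum_(i < n) l2norm (v i - average v) ^+ 2)%:E)%E.

End subsampling.

Section variance_terms.
Context (disp : measure_display) (T : measurableType disp) (R : realType).
Variable P : probability T R.
Context (n m : nat).
Variable x : 'I_n -> T -> 'rV[R]_m.

(* Meant for vectors of finite variance, for which [fine] loses nothing. *)
Definition sd (i : 'I_n) : R := Num.sqrt (fine (tr_var P (x i))).

Definition V_com (rho : R) (b : nat) (beff : \bar R) : R :=
  (rho * fine beff^-1%E + (1 - rho) / b%:R) *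
  (n%:R^-1 * \sum_(i < n) fine (tr_var P (x i))).

Definition V_cor (rho : R) (beff : \bar R) : R :=
  rho * (1 - fine beff^-1%E) * (n%:R^-1 * \sum_(i < n) sd i) ^+ 2.

Definition V_sub (beff : \bar R) : R :=
  fine beff^-1%E *
  (n%:R^-1 * \sum_(i < n)
    l2norm (mean_vector P (x i) -
            average (fun j => mean_vector P (x j))) ^+ 2).

End variance_terms.

(* Main.v *)
(* By independence, the moments of x_B are mixtures over the minibatch S, with
   weights pi(S), of the moments of the fixed-minibatch averages. The law of
   total variance then gives
     tr V[x_B] = E_S [b^-2 \sum_(i, j in S) C_ij] + tr V_S [mean of x_S],
   where C_ij = tr Cov(x_i, x_j), and the last term is V_sub. Replace C_ij for
   i <> j by rho s_i s_j, where s_i is the standard deviation of x_i: the first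
   term becomes
     (1 - rho) / b E_S [b^-1 \sum_(i in S) s_i ^ 2]
       + rho E_S [(b^-1 \sum_(i in S) s_i) ^ 2].
   Unbiasedness applied to the numbers s_i ^ 2 evaluates the first summand;
   unbiasedness and the effective sample size applied to the s_i evaluate the
   second one, and the result is V_com + V_cor. *)

Require Import Defs.
From HB Require Import structures.
From mathcomp Require Import all_boot all_order all_algebra.
From mathcomp Require Import all_classical all_reals all_analysis.
From mathcomp Require Import measurable_realfun ring lra.

Set Implicit Arguments.
Unset Strict Implicit.
Unset Printing Implicit Defensive.

Import Order.TTheory GRing.Theory Num.Theory.
Import numFieldNormedType.Exports.

Local Open Scope classical_set_scope.
Local Open Scope ring_scope.

(** * Integration over an event independent of the integrand *)

(* Independence says that the restriction of [P] to [A] and the multiple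
   [P A * P] have the same image under [g]. *)
Lemma ge0_integral_indep (disp : measure_display) (T : measurableType disp)
    (R : realType) (P : probability T R) (A : set T) (g : T -> R)
    (f : R -> \bar R) :
  measurable A -> measurable_fun [set: T] g -> measurable_fun [set: R] f ->
  (forall y, 0 <= f y)%E ->
  (forall U, measurable U -> P (A `&` g @^-1` U) = (P A * P (g @^-1` U))%E) ->
  (\int[P]_(w in A) f (g w) = P A * \int[P]_w f (g w))%E.
Proof.
move=> mA mg mf f0 PA.
pose mu : {measure set T -> \bar R} := mrestr P mA.
have PAfin : P A \is a fin_num by exact: fin_num_measure.
have PA0 : 0 <= fine (P A) by rewrite fine_ge0.
transitivity (\int[mu]_(w in A) f (g w))%E.
  by apply: eq_measure_integral => C mC CA; rewrite /mu/= /mrestr setIidl.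
(* [mu] gives no mass to the complement of [A], so the domain can grow to the whole space, where a
   change of variables along [g] is possible. *)
transitivity (\int[mu]_w f (g w))%E.
  rewrite [RHS](@ge0_negligible_integral _ _ _ mu [set: T] (~` A))//.
  - by rewrite setTD setCK.
  - exact: measurableC.
  - exact: measurableT_comp.
  - by rewrite /mu/= /mrestr setICl measure0.
pose nu : {measure set T -> \bar R} := mscale (NngNum PA0) P.
transitivity (\int[nu]_w f (g w))%E; last first.
  rewrite ge0_integral_mscale//= ?fineK//.
  exact: measurableT_comp.
have push (m : {measure set T -> \bar R}) :=
  @ge0_integral_pushforward _ _ _ _ _ g mg m setT f measurableT mf
    (fun y _ => f0 y).
(* Both sides are now integrals of [f] over the reals; it remains to compare the image measures, and
   [PA] does that. *)
rewrite -[LHS](push mu) -[RHS](push nu).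
apply: eq_measure_integral => U mU _.
by rewrite /nu /= /pushforward /mscale /= /mrestr setIC PA// fineK.
Qed.

(** The positive and negative parts of [g] are functions of [g], so the nonnegative case applies to
    each; integrability makes their integrals finite, so that [P A] distributes over the
    difference. *)
Lemma integral_indep (disp : measure_display) (T : measurableType disp)
    (R : realType) (P : probability T R) (A : set T) (g : T -> R) :
  measurable A -> P.-integrable [set: T] (EFin \o g) ->
  (forall U, measurable U -> P (A `&` g @^-1` U) = (P A * P (g @^-1` U))%E) ->
  (\int[P]_(w in A) (g w)%:E = P A * \int[P]_w (g w)%:E)%E.
Proof.
move=> mA ig PA.
have mg : measurable_fun [set: T] g.
  by move/measurable_int : ig => /measurable_EFinP.
rewrite integralE [in RHS]integralE muleBr.
- congr (_ - _)%E.
  + rewrite (funepos_comp EFin g).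
    apply: (@ge0_integral_indep _ _ _ _ _ _ (EFin^\+)%E) => //.
    exact: measurable_funepos.
  + rewrite (funeneg_comp EFin g).
    apply: (@ge0_integral_indep _ _ _ _ _ _ (EFin^\-)%E) => //.
    exact: measurable_funeneg.
- exact: fin_num_measure.
- apply: fin_num_adde_defl.
  by rewrite fin_numN integrable_fin_num//; exact: integrable_funeneg.
Qed.

(** The events [B = S] partition the space, and on each one the integrand is the fixed function
    [f S], which is independent of that event. *)
Lemma integral_mixture (disp : measure_display) (T : measurableType disp)
    (R : realType) (P : probability T R) (I : finType) (B : T -> I)
    (f : I -> T -> R) :
  (forall S, measurable (B @^-1` [set S])) ->
  (forall S, P.-integrable [set: T] (EFin \o f S)) ->
  (forall S U, measurable U ->
    P (B @^-1` [set S] `&` f S @^-1` U) =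
    (P (B @^-1` [set S]) * P (f S @^-1` U))%E) ->
  (\int[P]_w (f (B w) w)%:E =
   \sum_S P (B @^-1` [set S]) * \int[P]_w (f S w)%:E)%E.
Proof.
move=> mB fi PB.
transitivity
    (\int[P]_w \sum_S ((EFin \o f S) \_ (B @^-1` [set S])) w)%E.
  apply: eq_integral => w _.
  rewrite (bigD1 (B w))//= big1 ?adde0 => [|S SB].
    by rewrite patchT// inE.
  by rewrite patchN// notin_setE /= => BS; rewrite BS eqxx in SB.
rewrite integral_sum//.
  apply: eq_bigr => S _; rewrite -integral_mkcond.
  by apply: integral_indep => //; exact: PB.
move=> S; rewrite -integrable_mkcond//; exact: integrableS (fi S).
Qed.

(** * Integrable variables with a known real mean *)

(** Integrability and the real value of the integral are carried together, so that linear
    combinations leave no finiteness conditions to check. *)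
Definition has_mean (disp : measure_display) (T : measurableType disp)
    (R : realType) (P : probability T R) (f : T -> R) (e : R) : Prop :=
  P.-integrable [set: T] (EFin \o f) /\ (\int[P]_w (f w)%:E = e%:E)%E.

Section has_mean_theory.
Context (disp : measure_display) (T : measurableType disp) (R : realType).
Variable P : probability T R.
Implicit Types (f g : T -> R) (c e : R).

Lemma expectation_integral f : ('E_P[f] = \int[P]_w (f w)%:E)%E.
Proof. by rewrite unlock. Qed.

Lemma covariance_centered f g : covariance P f g =
  ('E_P[fun w => ((f w - fine 'E_P[f]) * (g w - fine 'E_P[g]))%R])%E.
Proof. by rewrite unlock. Qed.

Lemma has_mean_expectation f e : has_mean P f e -> ('E_P[f])%E = e%:E.
Proof. by move=> [_ fe]; rewrite unlock. Qed.

Lemma integrable_has_mean f :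
  P.-integrable [set: T] (EFin \o f) -> has_mean P f (fine ('E_P[f])%E).
Proof.
by move=> fi; split => //; rewrite unlock fineK// integrable_fin_num.
Qed.

Lemma has_mean_cst c : has_mean P (fun=> c) c.
Proof.
split; last by rewrite integral_cst//= probability_setT mule1.
exact: (@finite_measure_integrable_cst _ _ _ P).
Qed.

Lemma has_meanD f g e e' : has_mean P f e -> has_mean P g e' ->
  has_mean P (fun w => f w + g w) (e + e').
Proof.
move=> [fi fe] [gi ge]; split; first exact: (integrableD measurableT fi gi).
by rewrite EFinD -fe -ge -integralD_EFin.
Qed.

Lemma has_meanZ c f e : has_mean P f e -> has_mean P (fun w => c * f w) (c * e).
Proof.
move=> [fi fe]; split; first exact: (integrableZl measurableT c fi).
by rewrite EFinM -fe -(integralZl measurableT fi).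
Qed.

Lemma has_mean_sum (I : finType) (A : {pred I}) (f : I -> T -> R)
    (e : I -> R) : (forall i, has_mean P (f i) (e i)) ->
  has_mean P (fun w => \sum_(i in A) f i w) (\sum_(i in A) e i).
Proof.
move=> fe; split.
  apply: (eq_integrable _ (fun w => \sum_(i in A) (f i w)%:E)%E) => //.
    by move=> w _; rewrite /= sumEFin.
  by apply: integrable_sum => // i _; have [] := fe i.
under eq_integral do rewrite -sumEFin.
rewrite integral_sum//; last by move=> i; have [] := fe i.
by rewrite -sumEFin; apply: eq_bigr => i _; have [] := fe i.
Qed.

Lemma eq_has_mean f g e e' : f =1 g -> e = e' -> has_mean P f e ->
  has_mean P g e'.
Proof. by move=> /funext <- <-. Qed.

(** Finite variances make the centred variables square integrable, and their product is dominated by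
    the sum of their squares. *)
Lemma has_mean_covariance f g :
  P.-integrable [set: T] (EFin \o f) -> P.-integrable [set: T] (EFin \o g) ->
  (covariance P f f < +oo)%E -> (covariance P g g < +oo)%E ->
  has_mean P (fun w => (f w - fine ('E_P[f])%E) * (g w - fine ('E_P[g])%E))
    (fine (covariance P f g)).
Proof.
pose z (h : T -> R) w := h w - fine ('E_P[h])%E.
have mz h : P.-integrable [set: T] (EFin \o h) -> measurable_fun [set: T] (z h).
  move=> /measurable_int/measurable_EFinP mh.
  exact: measurable_funB.
have sqz h : P.-integrable [set: T] (EFin \o h) ->
    (covariance P h h < +oo)%E ->
    P.-integrable [set: T] (EFin \o (fun w => z h w ^+ 2)).
  move=> hi; rewrite covariance_centered expectation_integral => hh.
  apply/integrableP; split.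
    by apply/measurable_EFinP/measurable_funX; exact: mz.
  apply: le_lt_trans hh; rewrite le_eqVlt; apply/orP; left; apply/eqP.
  by apply: eq_integral => w _; rewrite /= ger0_norm// sqr_ge0.
move=> fi gi ff gg.
have fgi : P.-integrable [set: T] (EFin \o (fun w => z f w * z g w)).
  have fg2 := integrableD measurableT (sqz f fi ff) (sqz g gi gg).
  apply: (le_integrable _ _ _ fg2) => //.
    by apply/measurable_EFinP/measurable_funM; exact: mz.
  move=> w _ /=; rewrite lee_fin normrM [leRHS]ger0_norm ?addr_ge0 ?sqr_ge0//.
  rewrite -(real_normK (num_real (z f w))) -(real_normK (num_real (z g w))).
  set u := `|_|; set v := `|_|.
  (* This gives [2 * u * v <= u ^+ 2 + v ^+ 2], and [u * v] is nonnegative. *)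
  have : 0 <= (u - v) ^+ 2 by exact: sqr_ge0.
  have : 0 <= u by exact: normr_ge0.
  have : 0 <= v by exact: normr_ge0.
  by nra.
rewrite covariance_centered; exact: integrable_has_mean fgi.
Qed.

(** With centred variables [z i], the base of the square is [a * \sum_(i in S) z i w + s], and the
    cross term has mean 0. The centre [c] is arbitrary: it will be the mean over all minibatches, so
    the bias [s ^+ 2] of a fixed one survives. *)
Lemma has_mean_square (n : nat) (S : {set 'I_n}) (x : 'I_n -> T -> R)
    (a c : R) :
  (forall i, P.-integrable [set: T] (EFin \o x i)) ->
  (forall i, (covariance P (x i) (x i) < +oo)%E) ->
  has_mean P (fun w => (a * (\sum_(i in S) x i w) - c) ^+ 2)
    (a ^+ 2 * (\sum_(i in S) \sum_(j in S) fine (covariance P (x i) (x j))) +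
     (a * (\sum_(i in S) fine ('E_P[x i])%E) - c) ^+ 2).
Proof.
move=> xi xv.
pose m i := fine ('E_P[x i])%E; pose z i w := x i w - m i.
pose s := a * (\sum_(i in S) m i) - c.
have z0 i : has_mean P (z i) 0.
  have h := has_meanD (integrable_has_mean (xi i)) (has_mean_cst (- m i)).
  apply: eq_has_mean h => //.
  by rewrite subrr.
have zz i j : has_mean P (fun w => z i w * z j w)
    (fine (covariance P (x i) (x j))).
  exact: has_mean_covariance.
have h1 := has_meanZ (a ^+ 2)
  (has_mean_sum (mem S) (fun i => has_mean_sum (mem S) (zz i))).
have h2 := has_meanZ (2 * a * s) (has_mean_sum (mem S) z0).
apply: eq_has_mean (has_meanD h1 (has_meanD h2 (has_mean_cst (s ^+ 2)))).
  move=> w /=.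
  have -> : \sum_(i in S) x i w = \sum_(i in S) z i w + \sum_(i in S) m i.
    by rewrite -big_split/=; apply: eq_bigr => i _; rewrite /z subrK.
  under eq_bigr do rewrite -mulr_sumr.
  by rewrite -mulr_suml /s; ring.
by rewrite big1_eq mulr0 add0r.
Qed.

End has_mean_theory.

Lemma has_mean_mixture (disp : measure_display) (T : measurableType disp)
    (R : realType) (P : probability T R) (I : finType) (B : T -> I)
    (f : I -> T -> R) (e : I -> R) :
  (forall S, measurable (B @^-1` [set S])) ->
  (forall S, has_mean P (f S) (e S)) ->
  (forall S U, measurable U ->
    P (B @^-1` [set S] `&` f S @^-1` U) =
    (P (B @^-1` [set S]) * P (f S @^-1` U))%E) ->
  ('E_P[fun w => f (B w) w])%E = (\sum_S fine (P (B @^-1` [set S])) * e S)%:E.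
Proof.
move=> mB fe PB; rewrite unlock integral_mixture//; last first.
  by move=> S; have [] := fe S.
rewrite -sumEFin; apply: eq_bigr => S _; rewrite EFinM.
by have [_ ->] := fe S; rewrite fineK// fin_num_measure.
Qed.

(** * Expectation over a random subset as a finite sum *)

Definition expect (R : realType) (I : finType) (pi : probability {set I} R)
    (h : {set I} -> R) : R :=
  \sum_S fine (pi [set S]) * h S.

Section expect_theory.
Context (R : realType) (I : finType) (pi : probability {set I} R).
Implicit Types h : {set I} -> R.

(** This is the mixture formula with the identity for [B] and a constant for each [f S]; a constant
    is independent of every event. *)
Lemma expectE h : ('E_pi[h])%E = (expect pi h)%:E.
Proof.
rewrite (@has_mean_mixture _ _ _ pi _ id (fun S _ => h S) h) //.
- by move=> S; exact: has_mean_cst.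
- move=> S U _; rewrite -/(cst (h S)) preimage_cst; case: ifPn => _.
    by rewrite setIT probability_setT mule1.
  by rewrite setI0 measure0 mule0.
Qed.

Lemma expect_cst c : expect pi (fun=> c) = c.
Proof. by apply: EFin_inj; rewrite -expectE expectation_cst. Qed.

Lemma expectD h h' :
  expect pi (fun S => h S + h' S) = expect pi h + expect pi h'.
Proof. by rewrite -big_split; apply: eq_bigr => S _; rewrite mulrDr. Qed.

Lemma expectZ c h : expect pi (fun S => c * h S) = c * expect pi h.
Proof. by rewrite mulr_sumr; apply: eq_bigr => S _; rewrite mulrCA. Qed.

Lemma eq_expect h h' : h =1 h' -> expect pi h = expect pi h'.
Proof. by move=> /funext ->. Qed.

Lemma expect_sum (J : finType) (h : J -> {set I} -> R) :
  expect pi (fun S => \sum_j h j S) = \sum_j expect pi (h j).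
Proof.
rewrite exchange_big; apply: eq_bigr => S _; exact: mulr_sumr.
Qed.

Lemma le_expect h h' : (forall S, h S <= h' S) -> expect pi h <= expect pi h'.
Proof.
by move=> hh; apply: ler_sum => S _; rewrite ler_wpM2l// fine_ge0.
Qed.

End expect_theory.

Lemma mean_vector_expect (R : realType) (I : finType)
    (pi : probability {set I} R) (m : nat) (h : {set I} -> 'rV[R]_m) :
  mean_vector pi h = \row_k expect pi (fun S => h S ord0 k).
Proof. by apply/rowP => k; rewrite !mxE expectE. Qed.

Lemma tr_var_expect (R : realType) (I : finType)
    (pi : probability {set I} R) (m : nat) (h : {set I} -> 'rV[R]_m) :
  tr_var pi h =
  (\sum_k expect pi (fun S => (h S ord0 k - mean_vector pi h ord0 k) ^+ 2))%:E.
Proof.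
rewrite /tr_var /tr_cov /mxtrace -sumEFin; apply: eq_bigr => k _.
by rewrite mxE covariance_centered expectE mxE.
Qed.

(** * Law of total variance for the minibatch mean *)

Section minibatch_variance.
Context (disp : measure_display) (T : measurableType disp) (R : realType).
Variable P : probability T R.

Lemma covariance_ge0 (f : T -> R) : (0 <= covariance P f f)%E.
Proof.
by rewrite covariance_centered expectation_ge0// => w; rewrite -expr2 sqr_ge0.
Qed.

(** The other diagonal entries are nonnegative, so the trace bounds each one. *)
Lemma covariance_coordinate_lty (m : nat) (X : T -> 'rV[R]_m) k :
  (tr_var P X < +oo)%E ->
  (covariance P (coordinate X k) (coordinate X k) < +oo)%E.
Proof.
apply: le_lt_trans; rewrite /tr_var /tr_cov /mxtrace (bigD1 k)//= mxE.
by rewrite leeDl// sume_ge0// => l _; rewrite mxE covariance_ge0.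
Qed.

Lemma tr_cov_fine (m : nat) (X Y : T -> 'rV[R]_m) :
  integrable_vector P X -> integrable_vector P Y ->
  (tr_var P X < +oo)%E -> (tr_var P Y < +oo)%E ->
  tr_cov P X Y =
  (\sum_k fine (covariance P (coordinate X k) (coordinate Y k)))%:E.
Proof.
move=> Xi Yi Xv Yv; rewrite /tr_cov /mxtrace -sumEFin.
apply: eq_bigr => k _; rewrite mxE.
have XY := has_mean_covariance (Xi k) (Yi k)
  (covariance_coordinate_lty k Xv) (covariance_coordinate_lty k Yv).
by rewrite covariance_centered (has_mean_expectation XY).
Qed.

Context (n m b : nat) (x : 'I_n -> T -> 'rV[R]_m).

Lemma coordinate_minibatch_mean (S : {set 'I_n}) k w :
  minibatch_mean b (fun i => x i w) S ord0 k =
  b%:R^-1 * \sum_(i in S) coordinate (x i) k w.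
Proof. by rewrite mxE summxE. Qed.

Lemma measurable_coordinate i k :
  measurable_fun [set: g_sigma_algebraType
      (\bigcup_(i in [set: 'I_n]) \bigcup_(k in [set: 'I_m])
        preimage_set_system [set: T] (coordinate (x i) k) measurable)]
    (coordinate (x i) k).
Proof.
move=> _ U mU; apply: sub_sigma_algebra.
by exists i => //; exists k => //; exists U.
Qed.

(** For a fixed [S], [f] is measurable for the sigma-algebra generated by the vectors [x i]. The
    exponent [r] lets one statement serve first moments and centred second moments. *)
Lemma independent_minibatch (B : T -> {set 'I_n}) (S : {set 'I_n}) k
    (c : R) (r : nat) (U : set R) :
  independent_of_vectors P B x -> measurable U ->
  let f w := (minibatch_mean b (fun i => x i w) S ord0 k - c) ^+ r in
  P (B @^-1` [set S] `&` f @^-1` U) = (P (B @^-1` [set S]) * P (f @^-1` U))%E.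
Proof.
move=> B_x mU f; apply: B_x; first by exists [set S] => //; rewrite setTI.
rewrite -[_ @^-1` _]setTI.
suff mf : measurable_fun [set: g_sigma_algebraType
      (\bigcup_(i in [set: 'I_n]) \bigcup_(k in [set: 'I_m])
        preimage_set_system [set: T] (coordinate (x i) k) measurable)] f.
  exact: mf.
have -> : f = fun w =>
    (b%:R^-1 * (\sum_(i <- enum S) coordinate (x i) k w) - c) ^+ r.
  by apply/funext => w; rewrite /f coordinate_minibatch_mean big_enum.
apply: measurable_funX; apply: measurable_funB => //.
apply: measurable_funM => //; apply: measurable_sum => i.
exact: measurable_coordinate.
Qed.

Hypotheses (x_mean : forall i, integrable_vector P (x i))
  (x_var : forall i, (tr_var P (x i) < +oo)%E).
Variables (pi : probability {set 'I_n} R) (B : {RV P >-> {set 'I_n}}).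
Hypotheses (B_pi : forall S, distribution P B S = pi S)
  (B_x : independent_of_vectors P B x).

Let x_B w := minibatch_mean b (fun i => x i w) (B w).
Let xbar i := mean_vector P (x i).

Lemma has_mean_minibatch_mean S k :
  has_mean P (fun w => minibatch_mean b (fun i => x i w) S ord0 k)
    (minibatch_mean b xbar S ord0 k).
Proof.
pose h := has_meanZ b%:R^-1 (has_mean_sum (mem S)
  (fun i => integrable_has_mean (x_mean i k))).
apply: eq_has_mean h => [w|]; first by rewrite coordinate_minibatch_mean.
by rewrite mxE summxE; congr (_ * _); apply: eq_bigr => i _; rewrite mxE.
Qed.

Lemma expectation_minibatch (r : nat) k c (e : {set 'I_n} -> R) :
  (forall S, has_mean P
    (fun w => (minibatch_mean b (fun i => x i w) S ord0 k - c) ^+ r) (e S)) ->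
  ('E_P[fun w => ((x_B w ord0 k - c) ^+ r)%R] = (expect pi e)%:E)%E.
Proof.
move=> fe.
rewrite (has_mean_mixture (B := B) (f := fun S w =>
  (minibatch_mean b (fun i => x i w) S ord0 k - c) ^+ r) (e := e))//.
- by congr EFin; apply: eq_bigr => S _; rewrite -B_pi.
- by move=> S; rewrite -[_ @^-1` _]setTI; exact: measurable_funPT.
- by move=> S U mU; exact: independent_minibatch.
Qed.

Lemma mean_vector_minibatch :
  mean_vector P x_B = mean_vector pi (minibatch_mean b xbar).
Proof.
rewrite mean_vector_expect; apply/rowP => k; rewrite !mxE.
(* The first moment is the case [r = 1], [c = 0] of [expectation_minibatch]. *)
rewrite (_ : coordinate x_B k = fun w => (x_B w ord0 k - 0) ^+ 1).
  rewrite (expectation_minibatch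
    (e := fun S => minibatch_mean b xbar S ord0 k))//.
  move=> S; apply: eq_has_mean (has_mean_minibatch_mean S k) => // w.
  by rewrite subr0.
by apply/funext => w; rewrite subr0.
Qed.

(** Coordinate by coordinate, the second moment of a fixed minibatch about the overall mean is its
    variance ([within]) plus its squared bias ([between]). Averaging over [pi] and summing over
    coordinates gives the two terms. *)
Lemma tr_var_minibatch :
  tr_var P x_B =
  (expect pi (fun S => b%:R^-1 ^+ 2 *
     (\sum_(i in S) \sum_(j in S) fine (tr_cov P (x i) (x j)))) +
   fine (tr_var pi (minibatch_mean b xbar)))%:E.
Proof.
rewrite tr_var_expect/=; set mu := mean_vector pi _.
pose C k i j := fine (covariance P (coordinate (x i) k) (coordinate (x j) k)).
pose within k (S : {set 'I_n}) :=
  b%:R^-1 ^+ 2 * \sum_(i in S) \sum_(j in S) C k i j.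
pose between k S := (minibatch_mean b xbar S ord0 k - mu ord0 k) ^+ 2.
transitivity (\sum_k expect pi (fun S => within k S + between k S))%:E.
  rewrite /tr_var /tr_cov /mxtrace -sumEFin; apply: eq_bigr => k _.
  rewrite mxE covariance_centered.
  (* The mean of [x_B] is the mean over [pi] of the fixed-minibatch means, hence the centre [mu] is
     the same in both variances. *)
  have -> : fine ('E_P[coordinate x_B k])%E = mu ord0 k.
    by rewrite /mu -mean_vector_minibatch mxE.
  under eq_fun do rewrite -expr2.
  apply: expectation_minibatch => S.
  have h := has_mean_square S b%:R^-1 (mu ord0 k)
    (fun i => x_mean i k) (fun i => covariance_coordinate_lty k (x_var i)).
  apply: eq_has_mean h => [w|]; first by rewrite coordinate_minibatch_mean.
  rewrite /between; congr (_ + (_ - _) ^+ 2).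
  by rewrite mxE summxE; congr (_ * _); apply: eq_bigr => i _; rewrite mxE.
congr EFin; rewrite (eq_bigr _ (fun k _ => expectD pi (within k) (between k))).
rewrite big_split/= -expect_sum; congr (_ + _); apply: eq_expect => S.
rewrite -mulr_sumr; congr (_ * _); rewrite exchange_big; apply: eq_bigr => i _.
by rewrite exchange_big; apply: eq_bigr => j _; rewrite tr_cov_fine.
Qed.

End minibatch_variance.

(** * Moments of subsampled real numbers *)

Section scalar_subsampling.
Context (R : realType) (n b : nat) (pi : probability {set 'I_n} R).
Implicit Types s : 'I_n -> R.

Lemma scalar_average s :
  average (fun i => \row_(_ < 1) s i) ord0 ord0 = n%:R^-1 * \sum_i s i.
Proof. by rewrite mxE summxE; under eq_bigr do rewrite mxE. Qed.

Lemma scalar_minibatch_mean s (S : {set 'I_n}) :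
  minibatch_mean b (fun i => \row_(_ < 1) s i) S ord0 ord0 =
  b%:R^-1 * \sum_(i in S) s i.
Proof. by rewrite mxE summxE; under eq_bigr do rewrite mxE. Qed.

(** Numbers are treated as row vectors of length 1, to which the property of the strategy
    applies. *)
Lemma unbiased_scalar s : unbiased_strategy b pi ->
  expect pi (fun S => b%:R^-1 * \sum_(i in S) s i) = n%:R^-1 * \sum_i s i.
Proof.
move=> /(_ 1%N (fun i => \row_(_ < 1) s i)) /rowP/(_ ord0).
rewrite scalar_average mean_vector_expect mxE => <-.
by apply: eq_expect => S; rewrite scalar_minibatch_mean.
Qed.

Lemma l2norm_sqr (m : nat) (v : 'rV[R]_m) :
  l2norm v ^+ 2 = \sum_k v ord0 k ^+ 2.
Proof. by rewrite sqr_sqrtr// sumr_ge0// => k _; exact: sqr_ge0. Qed.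

Lemma sum_sqr_dev s : (0 < n)%N -> let c := n%:R^-1 * \sum_i s i in
  n%:R^-1 * (\sum_i (s i - c) ^+ 2) = n%:R^-1 * (\sum_i s i ^+ 2) - c ^+ 2.
Proof.
move=> n0 c; have n0R : n%:R != 0 :> R by rewrite pnatr_eq0 -lt0n.
have -> : \sum_i (s i - c) ^+ 2 =
    \sum_i s i ^+ 2 - 2 * c * (\sum_i s i) + n%:R * c ^+ 2.
  transitivity (\sum_i (s i ^+ 2 - 2 * c * s i + c ^+ 2)).
    by apply: eq_bigr => i _; ring.
  rewrite !big_split/= sumrN -mulr_sumr sumr_const card_ord.
  by rewrite -[_ *+ n]mulr_natl.
by rewrite /c; field.
Qed.

Lemma fine_tr_var_effective (beff : \bar R) (m : nat) (v : 'I_n -> 'rV[R]_m) :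
  effective_sample_size b pi beff ->
  fine (tr_var pi (minibatch_mean b v)) =
  fine beff^-1%E * (n%:R^-1 * \sum_(i < n) l2norm (v i - average v) ^+ 2).
Proof.
(* [1 <= beff] rules out 0 and [-oo], so the inverse is finite, also at [beff = +oo], where it is
   0. *)
move=> [beff1 ->]; rewrite fineM// fin_numV//.
  by rewrite gt_eqF// (lt_le_trans _ beff1)// lte01.
by rewrite gt_eqF// (lt_le_trans _ beff1)// ltNyr.
Qed.

(** The second moment is the variance, known from the effective sample size, plus the squared mean,
    known from unbiasedness. *)
Lemma effective_scalar (beff : \bar R) s : (0 < n)%N ->
  unbiased_strategy b pi -> effective_sample_size b pi beff ->
  let q := fine beff^-1%E in
  expect pi (fun S => (b%:R^-1 * \sum_(i in S) s i) ^+ 2) =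
  q * (n%:R^-1 * (\sum_i s i ^+ 2)) +
  (1 - q) * (n%:R^-1 * \sum_i s i) ^+ 2.
Proof.
move=> n0 pi_unb pi_beff q; pose c := n%:R^-1 * \sum_i s i; rewrite -/c.
pose mb (S : {set 'I_n}) := b%:R^-1 * \sum_(i in S) s i.
have mbE : expect pi mb = c by exact: unbiased_scalar.
have var : expect pi (fun S => (mb S - c) ^+ 2) =
    q * (n%:R^-1 * (\sum_i s i ^+ 2) - c ^+ 2).
  have := fine_tr_var_effective (fun i => \row_(_ < 1) s i) pi_beff.
  rewrite tr_var_expect pi_unb big_ord1 -sum_sqr_dev//.
  rewrite scalar_average -/q -/c /=.
  under eq_expect do rewrite scalar_minibatch_mean.
  move=> ->; do 2 congr (_ * _); apply: eq_bigr => i _.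
  by rewrite l2norm_sqr big_ord1 mxE mxE [X in _ + X]mxE scalar_average.
(* As [mb] has mean [c], the bracket added to the square has mean [c ^+ 2]. *)
transitivity (expect pi (fun S => (mb S - c) ^+ 2 + (2 * c * mb S - c ^+ 2))).
  by apply: eq_expect => S; rewrite -/(mb S); ring.
by rewrite !expectD expectZ expect_cst var mbE; ring.
Qed.

End scalar_subsampling.

(** A share [rho] of each diagonal term completes the off-diagonal terms to [rho] times a full
    square; the share [1 - rho] is left over. *)
Lemma sum_pairs (R : realType) (n : nat) (S : {set 'I_n}) (s : 'I_n -> R)
    (rho : R) :
  \sum_(i in S) \sum_(j in S)
    (if i == j then s i ^+ 2 else rho * s i * s j) =
  (1 - rho) * (\sum_(i in S) s i ^+ 2) + rho * (\sum_(i in S) s i) ^+ 2.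
Proof.
rewrite mulr_sumr expr2 mulr_suml mulr_sumr -big_split/=.
apply: eq_bigr => i iS; rewrite (bigD1 i)//= eqxx [in RHS](bigD1 i)//=.
rewrite (eq_bigr (fun j => rho * s i * s j)) => [|j /andP[_ ji]].
  by rewrite -mulr_sumr; ring.
by rewrite eq_sym (negbTE ji).
Qed.

(** * Comparison of the true covariances with their bounds *)

Theorem theorem1 (disp : measure_display) (T : measurableType disp)
    (R : realType) (P : probability T R) (n d b : nat)
    (x : 'I_n -> T -> 'rV[R]_d)
    (x_mean : forall i, integrable_vector P (x i))
    (x_var : forall i, (tr_var P (x i) < +oo)%E)
    (rho : R) (rho01 : 0 <= rho <= 1)
    (x_cov : forall i j, i != j ->
      (tr_cov P (x i) (x j) <= (rho * sd P x i * sd P x j)%:E)%E)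
    (pi : probability {set 'I_n} R) (beff : \bar R)
    (pi_strategy : subsampling_strategy b pi)
    (pi_unbiased : unbiased_strategy b pi)
    (pi_beff : effective_sample_size b pi beff)
    (B : {RV P >-> {set 'I_n}})
    (B_pi : forall S : set {set 'I_n}, distribution P B S = pi S)
    (B_x : independent_of_vectors P B x) :
  let x_B := fun w => minibatch_mean b (fun i => x i w) (B w) in
  let bound := V_com P x rho b beff + V_cor P x rho beff + V_sub P x beff in
  (tr_var P x_B <= bound%:E)%E /\
  ((forall i j, i != j ->
      tr_cov P (x i) (x j) = (rho * sd P x i * sd P x j)%:E) ->
   tr_var P x_B = bound%:E).
Proof.
move=> x_B bound.
have [/andP[b1 bn] _] := pi_strategy; have n0 := leq_trans b1 bn.
pose C i j := fine (tr_cov P (x i) (x j)).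
have CE i j : tr_cov P (x i) (x j) = (C i j)%:E by rewrite /C tr_cov_fine.
have C0 i : 0 <= C i i.
  rewrite /C tr_cov_fine// sumr_ge0// => k _.
  by rewrite fine_ge0// covariance_ge0.
pose s := sd P x.
have sE i : s i ^+ 2 = C i i by exact: sqr_sqrtr (C0 i).
pose q := fine beff^-1%E.
(* [D] agrees with [C] on the diagonal and has the right-hand sides of the correlation bound
   elsewhere. The variance is [V C] and the bound is [V D], both up to [V_sub]. *)
pose D i j := if i == j then s i ^+ 2 else rho * s i * s j.
pose V (K : 'I_n -> 'I_n -> R) := expect pi (fun S => b%:R^-1 ^+ 2 *
  (\sum_(i in S) \sum_(j in S) K i j)).
have varE : tr_var P x_B = (V C + V_sub P x beff)%:E.
  rewrite (tr_var_minibatch b x_mean x_var B_pi B_x); congr (_ + _)%:E.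
  exact: fine_tr_var_effective.
have boundE : bound = V D + V_sub P x beff.
  congr (_ + _).
  have -> : V D = (1 - rho) / b%:R *
        expect pi (fun S => b%:R^-1 * \sum_(i in S) s i ^+ 2) +
      rho * expect pi (fun S => (b%:R^-1 * \sum_(i in S) s i) ^+ 2).
    rewrite -!expectZ -expectD; apply: eq_expect => S.
    by rewrite sum_pairs; ring.
  rewrite unbiased_scalar// (effective_scalar s n0 pi_unbiased pi_beff) -/q.
  rewrite /V_com /V_cor -/q -/s (eq_bigr (fun i => s i ^+ 2)) => [|i _].
    by ring.
  by rewrite sE.
rewrite varE boundE; split.
  (* [V] is monotone in its kernel, because its weights are nonnegative. *)
  rewrite lee_fin lerD2r; apply: le_expect => S.
  rewrite ler_wpM2l ?sqr_ge0//; apply: ler_sum => i _; apply: ler_sum => j _.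
  rewrite /D; case: eqVneq => [->|ij]; first by rewrite sE.
  by have := x_cov _ _ ij; rewrite CE lee_fin.
move=> x_eq; congr (_ + _)%:E; apply: eq_expect => S; congr (_ * _).
apply: eq_bigr => i _; apply: eq_bigr => j _.
rewrite /D; case: eqVneq => [->|ij]; first by rewrite sE.
by have := x_eq _ _ ij; rewrite CE => -[].
Qed.
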